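(* Let $k$ be a field. The ideal $$I=\langle x^2,\ y^2,\ xyz\rangle=\langle x^2,xy,y^2\rangle\cap\langle x^2,y^2,z\rangle$$ of the polynomial ring $k[x,y,z]$ is not primary, but its integral closure $$\bar I=\langle x^2,\ y^2,\ xy\rangle$$ is primary.
   Context: For an ideal $I$ of a commutative ring $R$, an element $r\in R$ is integral over $I$ if there exist an integer $m\ge 1$ and elements $a_i\in I^i$, $i=1,\dots,m$, such that $r^m+a_1r^{m-1}+\cdots+a_{m-1}r+a_m=0$. The integral closure $\bar I$ of $I$ is the set of all elements of $R$ integral over $I$. *)

(* Defs.v *)
From mathcomp Require Import all_boot all_order all_algebra.
From mathcomp Require Import mpoly.

Set Implicit Arguments.
Unset Strict Implicit.
Unset Printing Implicit Defensive.

Import GRing.Theory.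
Local Open Scope ring_scope.

(* MathComp's `idealr` concerns decidable proper subsets (`{pred R}`).  Since
   membership in an ideal, and in its integral closure, is not decidable over
   a general ring, ideals are Prop-valued predicates here. *)
Definition is_ideal (R : comNzRingType) (I : R -> Prop) : Prop :=
  [/\ I 0, forall a b, I a -> I b -> I (a + b) & forall r a, I a -> I (r * a)].

Definition ideal_gen (R : comNzRingType) (S : R -> Prop) (r : R) : Prop :=
  exists (n : nat) (c g : 'I_n -> R),
    (forall i, S (g i)) /\ r = \sum_(i < n) c i * g i.

Lemma ideal_gen_is_ideal (R : comNzRingType) (S : R -> Prop) :
  is_ideal (ideal_gen S).
Proof.
split.
- exists 0%N, (fun=> 0), (fun=> 0); split; first by case.
  by rewrite big_ord0.
- move=> _ _ [m [c [g [Sg ->]]]] [n [d [h [Sh ->]]]].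
  exists (m + n)%N.
  exists (fun i => match split i with inl j => c j | inr j => d j end).
  exists (fun i => match split i with inl j => g j | inr j => h j end).
  split; first by move=> i; case: (split i).
  rewrite big_split_ord /=; congr (_ + _); apply: eq_bigr => i _.
    by rewrite -[lshift n i]/(unsplit (inl i)) unsplitK.
  by rewrite -[rshift m i]/(unsplit (inr i)) unsplitK.
- move=> r _ [n [c [g [Sg ->]]]].
  exists n, (fun i => r * c i), g; split=> //.
  by rewrite mulr_sumr; apply: eq_bigr => i _; rewrite mulrA.
Qed.

Definition ideal_span (R : comNzRingType) (s : seq R) : R -> Prop :=
  ideal_gen (fun r => r \in s).

(* The power I^n; the empty product makes I^0 the unit ideal. *)
Definition ideal_pow (R : comNzRingType) (I : R -> Prop) (n : nat) : R -> Prop :=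
  ideal_gen (fun r => exists g : 'I_n -> R,
    (forall i, I (g i)) /\ r = \prod_(i < n) g i).

Definition integral_over_ideal (R : comNzRingType) (I : R -> Prop) (r : R) :
    Prop :=
  exists (m : nat) (a : nat -> R),
    [/\ (1 <= m)%N,
        forall i, (1 <= i <= m)%N -> ideal_pow I i (a i)
      & r ^+ m + \sum_(1 <= i < m.+1) a i * r ^+ (m - i) = 0].

Definition integral_closure (R : comNzRingType) (I : R -> Prop) : R -> Prop :=
  fun r => integral_over_ideal I r.

Definition is_primary (R : comNzRingType) (Q : R -> Prop) : Prop :=
  [/\ is_ideal Q, ~ Q 1
    & forall a b, Q (a * b) -> Q a \/ exists n : nat, (0 < n)%N /\ Q (b ^+ n)].

(* Main.v *)
Require Import Defs.
From HB Require Import structures.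
From mathcomp Require Import all_boot all_order all_algebra.
From mathcomp Require Import mpoly ring.

Set Implicit Arguments.
Unset Strict Implicit.
Unset Printing Implicit Defensive.

Import GRing.Theory.
Local Open Scope ring_scope.

(* All ideals involved are monomial, so membership is read off the support.
   Grading k[x,y,z] by the degree in x and y identifies <x,y>^2 with the
   preimage of (T^2) under x |-> x T, y |-> y T.  Since (T^2) is integrally
   closed in R[T] for a domain R, and I maps into (T^2), the integral closure
   of I lies in <x,y>^2; conversely (x y)^2 = x^2 y^2 lies in I^2.  The ideal
   <x,y>^2 is primary because an element with nonzero constant term in T is a
   nonzerodivisor modulo T^2, while one without it squares into (T^2).  On the
   other hand x y z is in I, but neither x y nor any power of z is. *)

(** * Generated ideals and monomial ideals *)

Lemma ideal_sum (R : comNzRingType) (I : R -> Prop) (T : eqType) (r : seq T)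
    (F : T -> R) :
  is_ideal I -> (forall i, i \in r -> I (F i)) -> I (\sum_(i <- r) F i).
Proof.
by case=> I0 ID _ IF; rewrite big_seq; apply: big_ind.
Qed.

Lemma ideal_gen_incl (R : comNzRingType) (S : R -> Prop) (r : R) :
  S r -> ideal_gen S r.
Proof.
move=> Sr; exists 1%N, (fun=> 1), (fun=> r); split=> //.
by rewrite big_ord1 mul1r.
Qed.

Lemma ideal_gen_min (R : comNzRingType) (S I : R -> Prop) (r : R) :
  is_ideal I -> (forall s, S s -> I s) -> ideal_gen S r -> I r.
Proof.
move=> idI SI [n [c [g [Sg ->]]]]; apply: ideal_sum => // i _.
by case: idI => _ _; apply; apply: SI.
Qed.

(** Ideals are [Prop]-valued, so primariness is moved along pointwise equivalence instead of an
    equality of predicates. *)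
Lemma eq_is_primary (R : comNzRingType) (I J : R -> Prop) :
  (forall f, I f <-> J f) -> is_primary J -> is_primary I.
Proof.
move=> IJ [[J0 JD JM] J1 Jp]; split; first split.
- exact/IJ.
- by move=> a b /IJ Ja /IJ Jb; apply/IJ/JD.
- by move=> r a /IJ Ja; apply/IJ/JM.
- by move/IJ.
move=> a b /IJ/Jp[/IJ Ia|[n [n_gt0 /IJ Ib]]]; first by left.
by right; exists n.
Qed.

Lemma ideal_spanC (R : comNzRingType) (a b c f : R) :
  ideal_span [:: a; b; c] f <-> ideal_span [:: a; c; b] f.
Proof.
split; apply: ideal_gen_min (ideal_gen_is_ideal _) _ => s;
  by rewrite !inE => abc; apply: ideal_gen_incl; rewrite !inE [X in _ || X]orbC.
Qed.

Lemma ideal_span3P (R : comNzRingType) (a b c f : R) :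
  ideal_span [:: a; b; c] f -> exists p q r, f = p * a + q * b + r * c.
Proof.
apply: (ideal_gen_min (I := fun f => exists p q r, f = p * a + q * b + r * c)).
  split=> [|_ _ [p [q [r ->]]] [p' [q' [r' ->]]]|s _ [p [q [r ->]]]].
  - by exists 0, 0, 0; ring.
  - by exists (p + p'), (q + q'), (r + r'); ring.
  - by exists (s * p), (s * q), (s * r); ring.
move=> s; rewrite !inE => /or3P[]/eqP->.
- by exists 1, 0, 0; ring.
- by exists 0, 1, 0; ring.
- by exists 0, 0, 1; ring.
Qed.

(** The support of a sum lies in the union of the supports and that of a product in their sumset, so
    the right-hand condition defines an ideal; conversely [f] is the sum of its terms, each a
    multiple of a generator. *)
Lemma ideal_span_monomialP (n : nat) (R : comNzRingType) (s : seq 'X_{1..n})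
    (f : {mpoly R[n]}) :
  ideal_span [seq 'X_[m] | m <- s] f <->
  forall m, m \in msupp f -> has (fun g => (g <= m)%MM) s.
Proof.
split=> [|supp_f].
  apply: (ideal_gen_min (I := fun f => forall m, m \in msupp f -> has _ s)).
    split=> [m|p q Ip Iq m /msuppD_le|p q Iq m /msuppM_le].
    - by rewrite msupp0.
    - by rewrite mem_cat => /orP[/Ip|/Iq].
    case/allpairsP=> -[m1 m2] /= [_ /Iq/hasP[g sg gm] ->].
    by apply/hasP; exists g => //; apply: lepm_trans gm (lem_addl _ _).
  move=> _ /mapP[g sg ->] m; rewrite msuppX inE => /eqP->.
  by apply/hasP; exists g => //; apply: lepm_refl.
have idI := ideal_gen_is_ideal (fun r : {mpoly R[n]} => r \in [seq 'X_[m] | m <- s]).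
rewrite [f]mpolyE; apply: ideal_sum => // m /supp_f/hasP[g sg gm].
rewrite -(submK gm) mpolyXD -mul_mpolyC mulrA.
by case: idI => _ _; apply; apply/ideal_gen_incl/map_f.
Qed.

(** * Powers of ideals and divisibility by powers of a variable *)

Lemma ideal_pow_incl (R : comNzRingType) (I : R -> Prop) (n : nat)
    (g : 'I_n -> R) :
  (forall i, I (g i)) -> ideal_pow I n (\prod_(i < n) g i).
Proof. by move=> Ig; apply: ideal_gen_incl; exists g. Qed.

Lemma ideal_pow2_mul (R : comNzRingType) (I : R -> Prop) (a b : R) :
  I a -> I b -> ideal_pow I 2 (a * b).
Proof.
move=> Ia Ib; have := @ideal_pow_incl R I 2 (fun i => if i == 0 then a else b).
rewrite big_ord_recl big_ord1 /=; apply=> i.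
by case: ifP.
Qed.

(** Carries the coefficients of an integral equation over [I] into the powers of the principal ideal
    of [t]. *)
Lemma rmorph_ideal_pow (R S : comNzRingType) (phi : {rmorphism R -> S})
    (I : R -> Prop) (t : S) (n : nat) (a : R) :
  (forall r, I r -> exists b, phi r = b * t) ->
  ideal_pow I n a -> exists b, phi a = b * t ^+ n.
Proof.
move=> It; apply: (ideal_gen_min (I := fun a => exists b, phi a = b * t ^+ n)).
  split=> [|p q [b eb] [c ec]|p q [b eb]].
  - by exists 0; rewrite rmorph0 mul0r.
  - by exists (b + c); rewrite rmorphD eb ec mulrDl.
  - by exists (phi p * b); rewrite rmorphM eb mulrA.
move=> _ [g [Ig ->]].
have /fin_all_exists[b eb] i : exists b, phi (g i) = b * t by apply: It.
exists (\prod_(i < n) b i).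
by rewrite rmorph_prod (eq_bigr _ (fun i _ => eb i)) big_split prodr_const card_ord.
Qed.

(* Integral closedness of the ideals ('X^d) of R['X].  If F = G * 'X^d is
   integral over ('X^(d+1)), the coefficient of 'X^(d * m) in the equation
   of degree m reduces to G(0)^m = 0. *)
Lemma integral_polyXn (R : idomainType) (d m : nat) (a : nat -> {poly R})
    (F : {poly R}) :
  (forall i, (1 <= i <= m)%N -> exists b, a i = b * 'X^d ^+ i) ->
  F ^+ m + \sum_(1 <= i < m.+1) a i * F ^+ (m - i) = 0 ->
  exists G, F = G * 'X^d.
Proof.
elim: d => [|d IHd] ha eqF; first by exists F; rewrite expr0 mulr1.
(* The hypothesis for [d.+1] implies the one for [d], so [F = G * 'X^d]; one more factor ['X] must
   come from [G]. *)
have [i /ha[b ->]|//|G eG] := IHd.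
  by exists (b * 'X^i); rewrite exprS exprMn; ring.
suff: root G 0.
  case/factor_theorem=> H; rewrite subr0 => eH.
  by exists H; rewrite eG eH exprS mulrA.
move/(congr1 (coefp (d * m))): eqF; rewrite /= coefD coef_sum coef0.
(* The [i]-th term is divisible by ['X^(d * m + i)] with [i > 0], so it has no coefficient in degree
   [d * m]. *)
rewrite big_nat big1 ?addr0 => [|i /andP[i_gt0]]; last first.
  rewrite ltnS => i_le_m; have [|b ->] := ha i; first by rewrite i_gt0.
  rewrite eG exprMn -!exprM mulrACA -exprD coefMXn ifT //.
  by rewrite mulSn -addnA -mulnDr subnKC // -[X in (X < _)%N]add0n ltn_add2r.
rewrite eG exprMn -exprM coefMXn ltnn subnn -horner_coef0 horner_exp.
by move/eqP; rewrite expf_eq0 => /andP[].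
Qed.

(** In a domain, a zero of [F * H] at 0 must come from [F] when [H] does not vanish there; factors
    ['X] are thus split off [F] and cancelled one at a time. *)
Lemma polyXn_dvd_mulr (R : idomainType) (d : nat) (F G H : {poly R}) :
  ~~ root H 0 -> F * H = G * 'X^d -> exists G', F = G' * 'X^d.
Proof.
move=> nzH; elim: d F => [|d IHd] F eFH; first by exists F; rewrite expr0 mulr1.
have : root (F * H) 0 by rewrite eFH rootE hornerM hornerXn expr0n mulr0.
rewrite rootM (negbTE nzH) orbF => /factor_theorem[F']; rewrite subr0 => eF.
have [|G' eF'] := IHd F'; last by exists G'; rewrite eF eF' exprSr mulrA.
apply: (mulIf (negbT (polyX_eq0 R))); rewrite -[RHS]mulrA -exprSr -eFH eF; ring.
Qed.

(** * The grading by degree in x and y *)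

Section XYGrading.
Variable k : fieldType.

Definition xydeg (m : 'X_{1..3}) : nat :=
  (m 0%R + m 1%R)%N.

(* k[x,y,z] -> k[x,y,z][T], x |-> x T, y |-> y T, z |-> z, so that
   <x,y>^d is the preimage of (T^d). *)
Definition xyhomog : {mpoly k[3]} -> {poly {mpoly k[3]}} :=
  mmap (polyC \o mpolyC 3 (R := k))
       (fun i : 'I_3 => ('X_i)%:P * 'X^(i < 2)%N).

HB.instance Definition _ := GRing.RMorphism.on xyhomog.

Lemma xyhomogX (m : 'X_{1..3}) : xyhomog 'X_[m] = ('X_[m])%:P * 'X^(xydeg m).
Proof.
rewrite /xyhomog mmapX /mmap1.
under eq_bigr do rewrite exprMn -exprM.
rewrite big_split /= [in RHS]mpolyXE_id rmorph_prod /=.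
congr (_ * _); first by apply: eq_bigr => i _; rewrite rmorphXn.
rewrite !big_ord_recl big_ord0 /= !mul1n mul0n expr0 !mulr1 -exprD.
by congr ('X^(m _ + m _)); apply: val_inj.
Qed.

Lemma xyhomogE (f : {mpoly k[3]}) :
  xyhomog f =
    \sum_(m <- msupp f) (f@_m *: 'X_[m])%:P * 'X^(xydeg m).
Proof.
rewrite {1}[f]mpolyE rmorph_sum; apply: eq_bigr => m _.
by rewrite -mul_mpolyC rmorphM /= xyhomogX /xyhomog mmapC /= mulrA -polyCM.
Qed.

(** Each term keeps its monomial inside the coefficient of its power of T, so distinct terms never
    collide. *)
Lemma coef_xyhomog (f : {mpoly k[3]}) (m : 'X_{1..3}) :
  (xyhomog f)`_(xydeg m) @_ m = f@_m.
Proof.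
rewrite xyhomogE coef_sum [RHS](congr1 (mcoeff m) (mpolyE f)) !raddf_sum /=.
apply: eq_bigr => m' _; rewrite coefCM coefXn.
case: (eqVneq m m') => [->|ne]; first by rewrite eqxx mulr1.
rewrite mulr_natr mcoeffMn mcoeffZ mcoeffX eq_sym (negbTE ne) mulr0.
by rewrite mul0rn.
Qed.

Lemma xyhomog_dvdP (d : nat) (f : {mpoly k[3]}) :
  (exists g, xyhomog f = g * 'X^d) <->
  forall m, m \in msupp f -> (d <= xydeg m)%N.
Proof.
split=> [[g eg] m|hf].
  rewrite mcoeff_msupp -coef_xyhomog eg coefMXn.
  by case: ltnP; rewrite // mcoeff0 eqxx.
exists (\sum_(m <- msupp f) (f@_m *: 'X_[m])%:P * 'X^(xydeg m - d)).
rewrite xyhomogE mulr_suml big_seq [in RHS]big_seq.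
by apply: eq_bigr => m /hf dm; rewrite -mulrA -exprD subnK.
Qed.

End XYGrading.

(** * The ideals of the theorem *)

Lemma lepm3E (g m : 'X_{1..3}) :
  (g <= m)%MM = [&& g 0%R <= m 0%R, g 1%R <= m 1%R
                  & g 2%R <= m 2%R]%N.
Proof.
apply/mnm_lepP/and3P=> [le_gm|[le0 le1 le2] [[|[|[|//]]] lti]]; first by split.
- by rewrite (_ : Ordinal lti = 0) //; apply: val_inj.
- by rewrite (_ : Ordinal lti = 1) //; apply: val_inj.
- by rewrite (_ : Ordinal lti = 2) //; apply: val_inj.
Qed.

Section Ideals.
Variable k : fieldType.

Let x : {mpoly k[3]} := 'X_(0 : 'I_3).
Let y : {mpoly k[3]} := 'X_(1 : 'I_3).
Let z : {mpoly k[3]} := 'X_(2 : 'I_3).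
Let I := ideal_span [:: x ^+ 2; y ^+ 2; x * y * z].

Lemma span_x2_y2_xyzP (f : {mpoly k[3]}) :
  I f <-> forall m, m \in msupp f ->
    [|| 1 < m 0%R, 1 < m 1%R
      | [&& 0 < m 0%R, 0 < m 1%R & 0 < m 2%R]]%N.
Proof.
have := ideal_span_monomialP
  [:: U_(0%R) *+ 2; U_(1%R) *+ 2;
      U_(0%R) + U_(1%R) + U_(2%R)]%MM f.
rewrite /= -!mpolyXn !mpolyXD -/x -/y -/z -/I => ->.
by split=> hf m /hf; rewrite !lepm3E !mulmnE !mnmDE !mnm1E /= !andbT orbF.
Qed.

Lemma span_x2_xy_y2P (f : {mpoly k[3]}) :
  ideal_span [:: x ^+ 2; x * y; y ^+ 2] f <->
  forall m, m \in msupp f -> (2 <= xydeg m)%N.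
Proof.
have := ideal_span_monomialP
  [:: U_(0%R) *+ 2; U_(0%R) + U_(1%R); U_(1%R) *+ 2]%MM f.
rewrite /= -!mpolyXn !mpolyXD -/x -/y => ->.
split=> hf m /hf; rewrite !lepm3E !mulmnE !mnmDE !mnm1E /xydeg /= !andbT orbF;
  (* It only matters whether each exponent is 0, 1 or at least 2. *)
  by case: (m 0%R) (m 1%R) => [|[|?]] [|[|?]].
Qed.

Lemma span_x2_y2_zP (f : {mpoly k[3]}) :
  ideal_span [:: x ^+ 2; y ^+ 2; z] f <->
  forall m, m \in msupp f ->
    [|| 1 < m 0%R, 1 < m 1%R | 0 < m 2%R]%N.
Proof.
have := ideal_span_monomialP
  [:: U_(0%R) *+ 2; U_(1%R) *+ 2; U_(2%R)]%MM f.
rewrite /= -!mpolyXn -/x -/y -/z => ->.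
by split=> hf m /hf; rewrite !lepm3E !mulmnE !mnm1E /= !andbT orbF.
Qed.

Lemma x2_y2_xyz_not_primary : ~ is_primary I.
Proof.
case=> _ _ /(_ (x * y) z) [|/span_x2_y2_xyzP|[n [_ /span_x2_y2_xyzP]]].
- by apply: ideal_gen_incl; rewrite !inE eqxx !orbT.
- move/(_ (U_(0%R) + U_(1%R))%MM).
  by rewrite -mpolyXD msuppX inE eqxx !mnmDE !mnm1E => /(_ isT).
move/(_ (U_(2%R) *+ n)%MM).
by rewrite mpolyXn msuppX inE eqxx !mulmnE !mnm1E => /(_ isT).
Qed.

Lemma integral_closure_x2_y2_xyz (f : {mpoly k[3]}) :
  integral_closure I f <-> exists g, xyhomog f = g * 'X^2.
Proof.
split=> [[m [a [_ aI eqf]]]|].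
  apply: (integral_polyXn (m := m) (a := @xyhomog k \o a)) => [i /aI/=|].
    (* Every monomial of an element of [I] has degree at least 2 in x and y. *)
    apply: rmorph_ideal_pow => r /span_x2_y2_xyzP Ir.
    apply/xyhomog_dvdP => n /Ir; rewrite /xydeg.
    by case: (n 0%R) (n 1%R) => [|[|?]] [|[|?]].
  have := congr1 (@xyhomog k) eqf; rewrite rmorph0 rmorphD rmorphXn rmorph_sum /=.
  by under eq_bigr do rewrite rmorphM rmorphXn.
(* For f = u + q x y with u in I, the equation is (f - u)^2 = q^2 x^2 y^2. *)
move/xyhomog_dvdP/span_x2_xy_y2P/ideal_span3P=> [p [q [r ef]]].
have idI : is_ideal I := ideal_gen_is_ideal _.
have Ix : I (x ^+ 2) by apply: ideal_gen_incl; rewrite !inE eqxx.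
have Iy : I (y ^+ 2) by apply: ideal_gen_incl; rewrite !inE eqxx orbT.
case: (idI) => _ ID IM.
pose u := p * x ^+ 2 + r * y ^+ 2.
have Iu : I u by apply: ID; apply: IM.
(* The coefficients come from expanding the square; the second lies in the square of [I] because
   [u], [x ^+ 2] and [y ^+ 2] all lie in [I]. *)
exists 2, (fun i => if i == 1%N then - 2 * u
                  else u * u + - q ^+ 2 * (x ^+ 2 * y ^+ 2)).
split=> // [[|[|[|//]]] // _|].
- by have := @ideal_pow_incl _ I 1 (fun=> - 2 * u); rewrite big_ord1; apply=> _; apply: IM.
- have [_ pD pM] : is_ideal (ideal_pow I 2) := ideal_gen_is_ideal _.
  by apply: pD; [|apply: pM]; apply: ideal_pow2_mul.
rewrite big_nat_recl // big_nat1 /= ef /u; ring.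
Qed.

Lemma xyhomog_dvd2_primary :
  is_primary (fun f : {mpoly k[3]} => exists g, xyhomog f = g * 'X^2).
Proof.
split.
- split=> [|f1 f2 [g1 e1] [g2 e2]|r f [g e]].
  + by exists 0; rewrite rmorph0 mul0r.
  + by exists (g1 + g2); rewrite rmorphD /= e1 e2 mulrDl.
  + by exists (xyhomog r * g); rewrite rmorphM /= e mulrA.
- case=> g; rewrite rmorph1 => /(congr1 (coefp 0)).
  by rewrite /= coefMXn coef1 => /eqP; rewrite oner_eq0.
move=> a b; rewrite rmorphM /= => ab.
(* The value at T = 0 is the part of [b] free of x and y. *)
have [/factor_theorem[h]|nz] := boolP (root (xyhomog b) 0).
  rewrite subr0 => eb; right; exists 2; split=> //; exists (h ^+ 2).
  by rewrite rmorphXn /= eb exprMn.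
left; case: ab => g ab.
exact: polyXn_dvd_mulr nz ab.
Qed.

End Ideals.

Theorem mainTheorem4 (k : fieldType) :
  let x : {mpoly k[3]} := 'X_(0 : 'I_3) in
  let y : {mpoly k[3]} := 'X_(1 : 'I_3) in
  let z : {mpoly k[3]} := 'X_(2 : 'I_3) in
  let I := ideal_span [:: x ^+ 2; y ^+ 2; x * y * z] in
  [/\ forall f, I f <-> ideal_span [:: x ^+ 2; x * y; y ^+ 2] f /\
                        ideal_span [:: x ^+ 2; y ^+ 2; z] f,
      ~ is_primary I,
      forall f, integral_closure I f <-> ideal_span [:: x ^+ 2; y ^+ 2; x * y] f
    & is_primary (integral_closure I)].
Proof.
move=> x y z I; rewrite /I /z /y /x; split.
(* All three memberships are conditions on the support, so the intersection is checked one monomial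
   at a time. *)
- move=> f; rewrite span_x2_y2_xyzP span_x2_xy_y2P span_x2_y2_zP.
  split=> [hf|[h1 h2] m hm].
    by split=> m /hf; rewrite /xydeg;
      case: (m 0%R) (m 1%R) (m 2%R) => [|[|?]] [|[|?]] [|?].
  by move: (h1 m hm) (h2 m hm); rewrite /xydeg;
    case: (m 0%R) (m 1%R) (m 2%R) => [|[|?]] [|[|?]] [|?].
- exact: x2_y2_xyz_not_primary.
- by move=> f; rewrite integral_closure_x2_y2_xyz ideal_spanC xyhomog_dvdP span_x2_xy_y2P.
exact: eq_is_primary (@integral_closure_x2_y2_xyz k) (xyhomog_dvd2_primary k).
Qed.
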